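(* Let $G$ be a finite simple graph and $e\in E(G)$. Then \[\tau_G=\tau_{G\setminus e}-(x-1)\,\tau_{G/e},\] where $G\setminus e$ is $G$ with $e$ deleted and $G/e$ is the (simple, unweighted) graph obtained by contracting $e$, removing any loops and multiple edges.
   Context: $X_G=\sum_\kappa\prod_v x_{\kappa(v)}$ over proper colourings $\kappa:V(G)\to\{1,2,\dots\}$. $P_\lambda$ is the disjoint union of paths with $\lambda_1,\dots,\lambda_{\ell(\lambda)}$ vertices; $\{X_{P_\lambda}\}$ is a basis of the symmetric functions over $\mathbb{Q}$. The tree polynomial is $\tau_G(x)=\sum_\lambda a_\lambda x^{\ell(\lambda)}$ where $X_G=\sum_\lambda a_\lambda X_{P_\lambda}$. *)

(* Defs.v *)
From HB Require Import structures.
From mathcomp Require Import all_boot all_order all_algebra.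
From mathcomp Require Import mpoly.
From Stdlib Require Import ClassicalEpsilon.

Set Implicit Arguments.
Unset Strict Implicit.
Unset Printing Implicit Defensive.

Import Order.TTheory GRing.Theory Num.Theory.
Local Open Scope ring_scope.

(* A graph is a finite vertex type V with an adjacency relation E : rel V.
   Simple graphs: E symmetric and irreflexive (hypotheses of the theorem). *)

Definition proper_col (V : finType) (E : rel V) (N : nat) (k : {ffun V -> 'I_N}) :=
  [forall u, forall v, E u v ==> (k u != k v)].

(* Chromatic symmetric function of (V,E), truncated to N variables
   x_0,...,x_{N-1}. For N >= #|V| this truncation is faithful
   (Lambda^n -> Lambda^n_N is an isomorphism when N >= n). *)
Definition csf (N : nat) (V : finType) (E : rel V) : {mpoly rat[N]} :=
  \sum_(k : {ffun V -> 'I_N} | proper_col E k) \prod_(v : V) 'X_(k v).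

(* Partitions of n: n-tuples of numbers <= n, weakly decreasing, summing
   to n (trailing zeros are padding). *)
Definition is_ptn (n : nat) (t : n.-tuple 'I_n.+1) :=
  sorted geq [seq val i | i <- t] && (sumn [seq val i | i <- t] == n)%N.

Definition parts (n : nat) (t : n.-tuple 'I_n.+1) : seq nat :=
  [seq k <- [seq val i | i <- t] | k != 0%N].
Definition plen (n : nat) (t : n.-tuple 'I_n.+1) : nat := size (parts t).

(* Disjoint union of paths P_s with s_1, ..., s_l vertices: vertices
   0 .. sumn s - 1, the j-th block being the consecutive vertices from
   sumn (take j s) to sumn (take j.+1 s) - 1, each block a path. *)
Definition blk (s : seq nat) (u : nat) : nat :=
  find (fun j => (u < sumn (take j.+1 s))%N) (iota 0 (size s)).
Definition path_rel (s : seq nat) : rel 'I_(sumn s) :=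
  fun u v => ((u.+1 == v :> nat) || (v.+1 == u :> nat)) && (blk s u == blk s v).

Definition path_expansion (V : finType) (E : rel V)
    (a : #|V|.-tuple 'I_#|V|.+1 -> rat) : Prop :=
  csf #|V| E =
  \sum_(t : #|V|.-tuple 'I_#|V|.+1 | is_ptn t)
     a t *: csf #|V| (@path_rel (parts t)).

(* The coefficients a_lambda (unique since {X_{P_lambda}} is a basis). *)
Definition path_coeffs (V : finType) (E : rel V) : #|V|.-tuple 'I_#|V|.+1 -> rat :=
  epsilon (inhabits (fun _ => 0)) (fun a => path_expansion E a).

Definition tree_poly (V : finType) (E : rel V) : {poly rat} :=
  \sum_(t : #|V|.-tuple 'I_#|V|.+1 | is_ptn t) path_coeffs E t *: 'X^(plen t).

Definition del_edge (V : finType) (E : rel V) (x y : V) : rel V :=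
  fun u v => E u v && ~~ (((u == x) && (v == y)) || ((u == y) && (v == x))).

(* Contraction of the edge {x,y}: y is merged into x; vertex set V \ {y};
   loops removed (u != v), multiple edges collapse automatically. *)
Definition contr_vert (V : finType) (y : V) := {v : V | v != y}.
Definition contr_edge (V : finType) (E : rel V) (x y : V) : rel (contr_vert y) :=
  fun u v => (val u != val v) &&
    [|| E (val u) (val v), (val u == x) && E y (val v)
      | (val v == x) && E (val u) y].

(* Main.v *)
(** Specialising [x_1 = ... = x_q = 1] and the other variables to [0] in
    [X_G = sum_l a_l X_(P_l)], and counting the proper colourings of the paths,
    gives [chi_G(q) = sum_l a_l q ^ len(l) (q - 1) ^ (n - len(l))], that is,
    [tau_G(x) = (x - 1) ^ n chi_G(x / (x - 1))] with [n = |V(G)|].  The identity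
    is then deletion-contraction for the chromatic polynomial.  Only the values
    [q <= n] are available in [n] variables, but both sides are polynomials of
    degree at most [n].

    The coefficients [a_l] exist by deletion-contraction for vertex-weighted
    graphs, which reduces [X_G] to products of power sums, and these to
    products of paths; their uniqueness plays no role. *)

Require Import Defs.
From HB Require Import structures.
From mathcomp Require Import all_boot all_order all_algebra.
From mathcomp Require Import mpoly.
From Stdlib Require Import ClassicalEpsilon.
From mathcomp Require Import ring zify.

Set Implicit Arguments.
Unset Strict Implicit.
Unset Printing Implicit Defensive.

Import GRing.Theory Num.Theory.
Local Open Scope ring_scope.

(** * Weighted colouring sums and deletion-contraction *)

(** The weight depends on vertex and colour so that one sum covers $X_G$ (['X_i]), its
    vertex-weighted form (['X_i ^+ w v]) and its specialisations (scalars [z i]). *)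
Definition wcsf (R : comNzRingType) (N : nat) (V : finType) (E : rel V)
    (F : V -> 'I_N -> R) : R :=
  \sum_(k : {ffun V -> 'I_N} | proper_col E k) \prod_v F v (k v).

Lemma proper_colP (V : finType) (E : rel V) (N : nat) (k : {ffun V -> 'I_N}) :
  reflect (forall u v, E u v -> k u != k v) (proper_col E k).
Proof.
apply: (iffP forallP) => [h u v Euv | h u].
  by have /forallP/(_ v)/implyP/(_ Euv) := h u.
by apply/forallP => v; apply/implyP; apply: h.
Qed.

Lemma eq_proper_col (V : finType) (E E' : rel V) (N : nat)
    (k : {ffun V -> 'I_N}) :
  E =2 E' -> proper_col E k = proper_col E' k.
Proof.
by move=> eqE; apply/proper_colP/proper_colP => h u v;
  [rewrite -eqE | rewrite eqE]; apply: h.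
Qed.

Lemma proper_col_del (V : finType) (E : rel V) (N : nat) (x y : V)
    (k : {ffun V -> 'I_N}) :
  E x y -> proper_col E k = proper_col (del_edge E x y) k && (k x != k y).
Proof.
move=> Exy; apply/proper_colP/andP => [h | [/proper_colP h nk] u v Euv].
  split; last exact: h.
  by apply/proper_colP => u v /andP[Euv _]; apply: h.
have [/andP[/eqP-> /eqP->] //|n1] := boolP ((u == x) && (v == y)).
have [/andP[/eqP-> /eqP->] |n2] := boolP ((u == y) && (v == x)).
  by rewrite eq_sym.
by apply: h; rewrite /del_edge Euv negb_or n1.
Qed.

(** Used with multiplication for colour weights and with addition for the exponents [w v]. *)
Definition contr_weight (A : Type) (op : A -> A -> A) (V : finType) (x y : V)
    (F : V -> A) (u : contr_vert y) : A :=
  if val u == x then op (F x) (F y) else F (val u).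

Lemma big_contr (A : Type) (idx : A) (op : Monoid.com_law idx) (V : finType)
    (x y : V) (F : V -> A) :
  x != y ->
  \big[op/idx]_(u : contr_vert y) contr_weight op x F u = \big[op/idx]_v F v.
Proof.
move=> nxy.
rewrite /contr_weight.
rewrite -(big_sub (fun v => v != y)
  (fun v => if v == x then op (F x) (F y) else F v)) /=.
rewrite (bigD1 x) //= eqxx [RHS](bigD1 y) //= [in RHS](bigD1 x) //=.
rewrite [RHS]Monoid.mulmCA Monoid.mulmA; congr (op _ _).
by apply: eq_bigr => v /andP[_ /negPf->].
Qed.

(** Split the proper colourings of $G\setminus e$ by the colours of the ends of $e$: if they differ,
    the colouring is proper for $G$; if they agree, it is a proper colouring of $G/e$ whose merged
    vertex carries both weights. *)
Lemma wcsf_delcontr (R : comNzRingType) (N : nat) (V : finType) (E : rel V)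
    (F : V -> 'I_N -> R) (x y : V) :
  irreflexive E -> E x y ->
  wcsf E F = wcsf (del_edge E x y) F
    - wcsf (@contr_edge V E x y)
        (fun (u : contr_vert y) i => contr_weight *%R x (fun v => F v i) u).
Proof.
move=> Eirr Exy.
have nxy : x != y by apply: contraTneq Exy => ->; rewrite Eirr.
apply/eqP; rewrite eq_sym subr_eq; apply/eqP.
rewrite /wcsf (bigID (fun k : {ffun V -> 'I_N} => k x != k y)) /=.
congr (_ + _); first by apply: eq_bigl => k; rewrite -proper_col_del.
pose x' : contr_vert y := Sub x nxy.
(* [insubd x'] sends [y], the only vertex outside the subtype, to [x'], so [ext k] gives [y] the
   colour of [x]. *)
pose ext (k : {ffun contr_vert y -> 'I_N}) : {ffun V -> 'I_N} :=
  [ffun v => k (insubd x' v)].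
pose res (k : {ffun V -> 'I_N}) : {ffun contr_vert y -> 'I_N} :=
  [ffun u => k (val u)].
have insy : insubd x' y = x'.
  by apply: val_inj; rewrite val_insubd eqxx.
have insv v : v != y -> val (insubd x' v) = v by move=> h; rewrite val_insubd h.
rewrite (reindex_onto ext res) /=; last first.
  move=> k /andP[_]; rewrite negbK => /eqP kxy.
  apply/ffunP => v; rewrite !ffunE.
  by have [->|nv] := eqVneq v y; rewrite ?insy ?insv.
have extv k u : ext k (val u) = k u by rewrite ffunE valKd.
have exty k : ext k y = k x' by rewrite ffunE insy.
apply: eq_big => [k|k _].
  have -> : res (ext k) == k by apply/eqP/ffunP => u; rewrite ffunE extv.
  rewrite andbT exty -[x in ext k x]/(val x') extv eqxx andbT.
  apply/proper_colP/proper_colP => h u v.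
    move=> /andP[nuv]; rewrite -!extv; case/or3P.
    - move=> Euv; apply: h; rewrite /del_edge Euv /=.
      by rewrite (negPf (valP u)) (negPf (valP v)) andbF.
    - case/andP=> /eqP ux Eyv.
      have -> : u = x' by exact: val_inj.
      rewrite extv -exty; apply: h; rewrite /del_edge Eyv eqxx /=.
      by rewrite eq_sym (negPf nxy) /= -ux eq_sym.
    - case/andP=> /eqP vx Euy.
      have -> : v = x' by exact: val_inj.
      rewrite (extv _ x') -exty; apply: h; rewrite /del_edge Euy eqxx /=.
      by rewrite -vx (negPf nuv) /= [y == _]eq_sym (negPf (valP v)) andbF.
  rewrite /del_edge => /andP[Euv].
  rewrite !ffunE negb_or => /andP[n1 n2].
  apply: h; rewrite /contr_edge.
  have nuv : u != v by apply: contraTneq Euv => ->; rewrite Eirr.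
  have [uy|nu] := eqVneq u y.
    subst u; rewrite insy insv 1?eq_sym //=.
    move: n2; rewrite eqxx /= => n2.
    by rewrite n2 eqxx Euv orbT.
  have [vy|nv] := eqVneq v y.
    subst v; rewrite insy insv //=.
    move: n1; rewrite eqxx andbT => n1.
    by rewrite n1 eqxx Euv !orbT.
  by rewrite !insv // nuv Euv.
rewrite -(@big_contr _ _ _ V x y) //; apply: eq_bigr => u _.
rewrite /contr_weight; case: eqP => ux; last by rewrite extv.
have -> : u = x' by exact: val_inj.
by rewrite exty -[x in ext k x]/(val x') extv.
Qed.

Lemma eq_wcsf (R : comNzRingType) (N : nat) (V : finType) (E : rel V)
    (F F' : V -> 'I_N -> R) :
  F =2 F' -> wcsf E F = wcsf E F'.
Proof.
by move=> eqF; apply: eq_bigr => k _; apply: eq_bigr => v _; apply: eqF.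
Qed.

Lemma wcsf_edgeless (R : comNzRingType) (N : nat) (V : finType) (E : rel V)
    (F : V -> 'I_N -> R) :
  (forall u v, ~~ E u v) -> wcsf E F = \prod_v \sum_i F v i.
Proof.
move=> E0; rewrite bigA_distr_bigA /=; apply: eq_bigl => k.
by apply/proper_colP => u v; rewrite (negPf (E0 u v)).
Qed.

Lemma del_edge_irr (V : finType) (E : rel V) (x y : V) :
  irreflexive E -> irreflexive (del_edge E x y).
Proof. by move=> Eirr u; rewrite /del_edge Eirr. Qed.

Lemma contr_edge_irr (V : finType) (E : rel V) (x y : V) :
  irreflexive (@contr_edge V E x y).
Proof. by move=> u; rewrite /contr_edge eqxx. Qed.

Lemma card_contr_vert (V : finType) (y : V) : #|{: contr_vert y}| = #|V|.-1.
Proof. by rewrite card_sig -(cardC1 y). Qed.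

(** Outer induction on the number of vertices, inner on the number of adjacent ordered pairs:
    contraction lowers the first, deletion the second. [P] ranges over all vertex types because
    contraction changes the type. *)
Lemma delcontr_ind (P : forall V : finType, rel V -> Prop) :
    (forall (V : finType) (E : rel V), (forall u v, ~~ E u v) -> P V E) ->
    (forall (V : finType) (E : rel V) (x y : V), irreflexive E -> E x y ->
       P V (del_edge E x y) -> P _ (@contr_edge V E x y) -> P V E) ->
  forall (V : finType) (E : rel V), irreflexive E -> P V E.
Proof.
move=> P0 PS V E; have [n] := ubnP #|V|.
elim: n V E => // n IHn V E; rewrite ltnS => leV.
have [m] := ubnP #|[pred p : V * V | E p.1 p.2]|.
elim: m E => // m IHm E; rewrite ltnS => leE Eirr.
case: (pickP [pred p : V * V | E p.1 p.2]) => [[x y] /= Exy | E0]; last first.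
  by apply: P0 => u v; have /= -> := E0 (u, v).
apply: (PS V E x y) => //.
  apply: IHm (del_edge_irr x y Eirr); apply: leq_trans leE.
  apply: proper_card; apply/properP; split.
    by apply/subsetP => -[u v] /andP[].
  by exists (x, y); rewrite !inE //= /del_edge !eqxx andbF.
apply: IHn; last exact: contr_edge_irr.
have : (0 < #|V|)%N by apply/card_gt0P; exists x.
by rewrite card_contr_vert; lia.
Qed.

(** Idempotent weights survive merging, so contraction keeps [z] and the recursion is that of the
    chromatic polynomial. A rational idempotent is 0 or 1, hence [\sum_i z i] counts the available
    colours; [p] is chosen before [N] and [z]. *)
Lemma chromatic_polyP (V : finType) (E : rel V) :
  irreflexive E ->
  exists2 p : {poly rat}, (size p <= #|V|.+1)%N &
    forall (N : nat) (z : 'I_N -> rat), (forall i, z i * z i = z i) ->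
      wcsf E (fun=> z) = p.[\sum_i z i].
Proof.
move: V E; apply: delcontr_ind => [V E E0 | V E x y Eirr Exy [p szp hp] [q szq hq]].
  exists 'X^#|V|; first by rewrite size_polyXn.
  by move=> N z _; rewrite wcsf_edgeless // prodr_const hornerXn.
exists (p - q).
  rewrite (leq_trans (size_polyD _ _)) // size_polyN geq_max szp.
  by apply: leq_trans szq _; rewrite card_contr_vert; lia.
move=> N z zz; rewrite (wcsf_delcontr _ Eirr Exy) hp // hornerD hornerN.
congr (_ - _); rewrite -hq //; apply: eq_wcsf => u i.
by rewrite /contr_weight zz if_same.
Qed.

(** * Factorisation over the blocks of a union of paths *)

Definition glue (m n : nat) (T : Type) (k1 : {ffun 'I_m -> T})
    (k2 : {ffun 'I_n -> T}) : {ffun 'I_(m + n) -> T} :=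
  [ffun i => match split i with inl a => k1 a | inr b => k2 b end].

Lemma glue_lshift (m n : nat) (T : Type) (k1 : {ffun 'I_m -> T})
    (k2 : {ffun 'I_n -> T}) a : glue k1 k2 (lshift n a) = k1 a.
Proof. by rewrite ffunE -[lshift n a]/(unsplit (inl a)) unsplitK. Qed.

Lemma glue_rshift (m n : nat) (T : Type) (k1 : {ffun 'I_m -> T})
    (k2 : {ffun 'I_n -> T}) b : glue k1 k2 (rshift m b) = k2 b.
Proof. by rewrite ffunE -[rshift m b]/(unsplit (inr b)) unsplitK. Qed.

Lemma big_glue (R : Type) (idx : R) (op : Monoid.com_law idx) (m n : nat)
    (T : finType) (P : pred {ffun 'I_(m + n) -> T}) (G : _ -> R) :
  \big[op/idx]_(k | P k) G k =
  \big[op/idx]_(p : {ffun 'I_m -> T} * {ffun 'I_n -> T} | P (glue p.1 p.2))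
     G (glue p.1 p.2).
Proof.
apply: (reindex (fun p => glue p.1 p.2)); apply: onW_bij.
exists (fun k : {ffun 'I_(m + n) -> T} =>
          ([ffun a => k (lshift n a)], [ffun b => k (rshift m b)])).
  case=> k1 k2 /=; congr pair; apply/ffunP => i; rewrite ffunE.
    exact: glue_lshift.
  exact: glue_rshift.
move=> k; apply/ffunP => i; rewrite -(splitK i).
by case: (split i) => j /=; rewrite ?glue_lshift ?glue_rshift ffunE.
Qed.

Lemma proper_col_glue (m n N : nat) (E : rel 'I_(m + n))
    (k1 : {ffun 'I_m -> 'I_N}) (k2 : {ffun 'I_n -> 'I_N}) :
  proper_col E (glue k1 k2) =
  [&& proper_col (fun a b => E (lshift n a) (lshift n b)) k1,
      proper_col (fun a b => E (rshift m a) (rshift m b)) k2 &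
      [forall a, forall b,
         E (lshift n a) (rshift m b) || E (rshift m b) (lshift n a)
           ==> (k1 a != k2 b)]].
Proof.
apply/proper_colP/and3P => [h | [/proper_colP h1 /proper_colP h2 /forallP h3]].
  split.
  - by apply/proper_colP => a b /h; rewrite !glue_lshift.
  - by apply/proper_colP => a b /h; rewrite !glue_rshift.
  apply/forallP => a; apply/forallP => b; apply/implyP.
  by case/orP => /h; rewrite glue_lshift glue_rshift // eq_sym.
move=> u v; rewrite -(splitK u) -(splitK v).
case: (split u) => i; case: (split v) => j /= Eij;
  rewrite ?glue_lshift ?glue_rshift; [exact: h1 | | | exact: h2].
  by move/forallP/(_ j)/implyP: (h3 i); apply; rewrite Eij.
by rewrite eq_sym; move/forallP/(_ i)/implyP: (h3 j); apply; rewrite Eij orbT.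
Qed.

(** A single path, kept apart from [path_rel [:: k]], which lives on ['I_(k + 0)]. *)
Definition line_rel (k : nat) : rel 'I_k :=
  fun u v => (u.+1 == v :> nat) || (v.+1 == u :> nat).

Lemma blk_cons_lt (k : nat) (s : seq nat) (u : nat) :
  (u < k)%N -> blk (k :: s) u = 0%N.
Proof. by move=> ltuk; rewrite /blk /= take0 /= addn0 ltuk. Qed.

Lemma blk_cons_add (k : nat) (s : seq nat) (u : nat) :
  blk (k :: s) (k + u)%N = (blk s u).+1.
Proof.
rewrite /blk /= take0 /= addn0 ltnNge leq_addr /= (iotaDl 1 0) find_map.
by congr _.+1; apply: eq_find => j /=; rewrite ltn_add2l.
Qed.

Lemma wcsf_path_nil (R : comNzRingType) (N : nat) (z : 'I_N -> R) :
  wcsf (@path_rel [::]) (fun=> z) = 1.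
Proof.
by rewrite wcsf_edgeless => [|[]//]; rewrite big_pred0 // => -[].
Qed.

Lemma wcsf_path_cons (R : comNzRingType) (N : nat) (z : 'I_N -> R) k s :
  wcsf (@path_rel (k :: s)) (fun=> z) =
  wcsf (@line_rel k) (fun=> z) * wcsf (@path_rel s) (fun=> z).
Proof.
rewrite /wcsf /= (@big_glue _ _ _ k (sumn s)) big_distrlr /= pair_big /=.
apply: eq_big => [[k1 k2] | [k1 k2] _] /=; last first.
  rewrite big_split_ord; congr (_ * _); apply: eq_bigr => i _.
    by rewrite glue_lshift.
  by rewrite glue_rshift.
rewrite proper_col_glue andbA -[RHS]andbT; congr (_ && _); last first.
  (* No edge crosses: the block index is 0 on the left and a successor on the right. *)
  apply/forallP => a; apply/forallP => b; apply/implyP.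
  by rewrite /path_rel /= blk_cons_lt // blk_cons_add !andbF.
congr (_ && _); apply: eq_proper_col => a b; rewrite /path_rel /line_rel /=.
  by rewrite !blk_cons_lt // eqxx andbT.
by rewrite !blk_cons_add eqSS -!addnS !eqn_add2l.
Qed.

Lemma wcsf_path (R : comNzRingType) (N : nat) (z : 'I_N -> R) s :
  wcsf (@path_rel s) (fun=> z) = \prod_(k <- s) wcsf (@line_rel k) (fun=> z).
Proof.
elim: s => [|k s IHs]; first by rewrite big_nil wcsf_path_nil.
by rewrite wcsf_path_cons big_cons IHs.
Qed.

(** * Colourings of one path, vertex by vertex *)

(** [P] constrains the colour of the first vertex; quantifying over [v] equal to 0 makes this
    vacuous when [k] is 0. *)
Definition line_sum (R : comNzRingType) (N : nat) (z : 'I_N -> R) (k : nat)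
    (P : pred 'I_N) : R :=
  \sum_(c : {ffun 'I_k -> 'I_N} |
        proper_col (@line_rel k) c &&
        [forall v : 'I_k, (v == 0%N :> nat) ==> P (c v)])
     \prod_v z (c v).

Lemma wcsf_line (R : comNzRingType) (N : nat) (z : 'I_N -> R) k :
  wcsf (@line_rel k) (fun=> z) = line_sum z k predT.
Proof.
apply: eq_bigl => c; rewrite -[LHS]andbT; congr (_ && _).
by apply/esym/forallP => v; rewrite implybT.
Qed.

Lemma line_sum0 (R : comNzRingType) (N : nat) (z : 'I_N -> R) P :
  line_sum z 0 P = 1.
Proof.
transitivity (wcsf (@line_rel 0) (fun=> z)).
  apply: eq_bigl => c; rewrite -[RHS]andbT; congr (_ && _).
  by apply/forallP => -[].
by rewrite wcsf_edgeless => [|[]//]; rewrite big_pred0 // => -[].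
Qed.

(** Fix the colour [d] of the first vertex; what remains is a shorter path whose first colour avoids
    [d]. *)
Lemma line_sumS (R : comNzRingType) (N : nat) (z : 'I_N -> R) k P :
  line_sum z k.+1 P = \sum_(d | P d) z d * line_sum z k (predC1 d).
Proof.
rewrite {1}/line_sum (@big_glue _ _ _ 1 k) /=.
rewrite (eq_bigl (fun p : {ffun 'I_1 -> 'I_N} * {ffun 'I_k -> 'I_N} =>
   P (p.1 ord0) && (proper_col (@line_rel k) p.2 &&
     [forall v : 'I_k, (v == 0%N :> nat) ==> predC1 (p.1 ord0) (p.2 v)]))); last first.
  case=> k1 k2 /=.
  have glue0 : (glue k1 k2 : {ffun 'I_k.+1 -> 'I_N}) ord0 = k1 ord0.
    by rewrite -[RHS](glue_lshift k1 k2); congr (fun_of_fin _ _); apply: val_inj.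
  rewrite -[X in X && _]/(@proper_col 'I_(1 + k) (@line_rel (1 + k)) N
    (glue k1 k2)) proper_col_glue.
  have -> : proper_col (fun a b => line_rel (lshift k a) (lshift k b)) k1.
    by apply/proper_colP => a b; rewrite !ord1.
  rewrite andTb andbC; congr (_ && (_ && _)).
  - apply/forallP/idP => [/(_ ord0) | h v]; first by rewrite glue0.
    by apply/implyP => /eqP v0; rewrite (_ : v = ord0) ?glue0 //; apply: val_inj.
  apply/forallP/forallP => [h v|h a].
    have /forallP/(_ v) := h ord0; rewrite /line_rel => /implyP h1.
    by apply/implyP => /eqP v0; rewrite eq_sym h1 //= v0.
  apply/forallP => v; rewrite /line_rel /= ord1; apply/implyP => h1.
  rewrite eq_sym; apply: (implyP (h v)).
  by case: (val v) h1.
rewrite -(pair_big_dep (fun k1 : {ffun 'I_1 -> 'I_N} => P (k1 ord0))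
  (fun (k1 : {ffun 'I_1 -> 'I_N}) k2 => proper_col (@line_rel k) k2 &&
     [forall v : 'I_k, (v == 0%N :> nat) ==> predC1 (k1 ord0) (k2 v)])
  (fun k1 k2 => \prod_v z (glue k1 k2 v))) /=.
rewrite (reindex (fun d => [ffun _ => d] : {ffun 'I_1 -> 'I_N})) /=; last first.
  apply: onW_bij; exists (fun c : {ffun 'I_1 -> 'I_N} => c ord0).
    by move=> d; rewrite ffunE.
  by move=> c; apply/ffunP => i; rewrite ffunE [i]ord1.
apply: eq_big => [d|d _]; first by rewrite ffunE.
rewrite big_distrr ffunE; apply: eq_bigr => k2 _.
rewrite (@big_split_ord _ _ _ 1 k) big_ord1 glue_lshift ffunE; congr (_ * _).
by apply: eq_bigr => i _; rewrite glue_rshift.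
Qed.

(** Each further vertex contributes the sum of [z] over colours other than its predecessor's. The
    factor [z c] turns the missing [z c] into 1 by idempotence, so the contribution does not depend
    on [c]. *)
Lemma line_sum_idem (R : comNzRingType) (N : nat) (z : 'I_N -> R) k c :
  (forall i, z i * z i = z i) ->
  z c * line_sum z k (predC1 c) = z c * (\sum_i z i - 1) ^+ k.
Proof.
move=> zz; elim: k c => [|k IHk] c; first by rewrite line_sum0 expr0.
rewrite line_sumS; under eq_bigr do rewrite IHk.
rewrite -big_distrl /= exprS !mulrA; congr (_ * _).
by rewrite [in RHS](bigD1 c) //= mulrBr mulrDr zz mulr1 addrAC subrr add0r.
Qed.

Lemma size_le_sumn (s : seq nat) : all (leq 1) s -> (size s <= sumn s)%N.
Proof. by elim: s => //= j s IHs /andP[? /IHs]; lia. Qed.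

(** With $S$ the sum of [z], a path on $k+1$ vertices gives $S(S-1)^k$. Positive entries make the
    truncated subtraction exact. *)
Lemma wcsf_path_idem (R : comNzRingType) (N : nat) (z : 'I_N -> R) s :
  (forall i, z i * z i = z i) -> all (leq 1) s ->
  wcsf (@path_rel s) (fun=> z) =
  (\sum_i z i) ^+ size s * (\sum_i z i - 1) ^+ (sumn s - size s).
Proof.
move=> zz; rewrite wcsf_path; elim: s => [|[//|k] s IHs] /=.
  by rewrite big_nil !expr0 mulr1.
move=> s_gt0; rewrite big_cons IHs // wcsf_line line_sumS.
rewrite (eq_bigr _ (fun d _ => line_sum_idem k d zz)).
rewrite -big_distrl /=.
have le_s := size_le_sumn s_gt0.
have -> : (k.+1 + sumn s - (size s).+1 = k + (sumn s - size s))%N by lia.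
by rewrite exprS exprD mulrACA.
Qed.

(** * Chromatic symmetric functions lie in the span of unions of paths *)

Lemma csfE (N : nat) (V : finType) (E : rel V) :
  csf N E = wcsf E (fun _ i => 'X_i : {mpoly rat[N]}).
Proof. by []. Qed.

Lemma csf_path_cat (N : nat) (s t : seq nat) :
  csf N (@path_rel (s ++ t)) = csf N (@path_rel s) * csf N (@path_rel t).
Proof. by rewrite !csfE !wcsf_path big_cat. Qed.

Lemma csf_path_perm (N : nat) (s t : seq nat) :
  perm_eq s t -> csf N (@path_rel s) = csf N (@path_rel t).
Proof. by move=> st; rewrite !csfE !wcsf_path; apply: perm_big. Qed.

(** Linear combinations of $X_{P_s}$ of degree [d], built one term at a time. The lists [s] need not
    be sorted, so that products correspond to concatenation. *)
Inductive path_span (N d : nat) : {mpoly rat[N]} -> Prop :=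
| PathSpan0 : path_span d 0
| PathSpanD s a f : all (leq 1) s -> sumn s = d -> path_span d f ->
    path_span d (a *: csf N (@path_rel s) + f).

Lemma path_span_path (N : nat) (s : seq nat) :
  all (leq 1) s -> path_span (sumn s) (csf N (@path_rel s)).
Proof.
move=> s_gt0; rewrite -[csf _ _]addr0 -[csf _ _]scale1r.
by apply: PathSpanD => //; apply: PathSpan0.
Qed.

Lemma path_span_lin (N d : nat) (a : rat) (f g : {mpoly rat[N]}) :
  path_span d f -> path_span d g -> path_span d (a *: f + g).
Proof.
move=> + dg; elim=> [|s b h s_gt0 sd _ IH]; first by rewrite scaler0 add0r.
by rewrite scalerDr scalerA -addrA; apply: PathSpanD.
Qed.

Lemma path_span_sub (N d : nat) (f g : {mpoly rat[N]}) :
  path_span d f -> path_span d g -> path_span d (f - g).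
Proof.
by move=> df dg; rewrite addrC -scaleN1r; apply: path_span_lin.
Qed.

Lemma path_span_mul (N d e : nat) (f g : {mpoly rat[N]}) :
  path_span d f -> path_span e g -> path_span (d + e) (f * g).
Proof.
move=> df eg; elim: df => [|s a h s_gt0 sd _ IH].
  by rewrite mul0r; apply: PathSpan0.
rewrite mulrDl -scalerAl; apply: path_span_lin IH.
elim: eg => [|t b k t_gt0 te _ IH]; first by rewrite mulr0; apply: PathSpan0.
rewrite mulrDr -scalerAr -csf_path_cat; apply: path_span_lin IH.
by rewrite -sd -te -sumn_cat; apply: path_span_path; rewrite all_cat s_gt0 t_gt0.
Qed.

(* The sum below is the chromatic symmetric function of a path on [k + 1]
   vertices whose first vertex has weight [j + 1]; deleting or contracting its
   first edge gives the recursion on [j]. *)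
Lemma path_span_weighted_path (N j k : nat) :
  path_span (j.+1 + k)
    (\sum_c 'X_c ^+ j.+1 * line_sum (fun i => 'X_i : {mpoly rat[N]}) k (predC1 c)).
Proof.
pose L k := line_sum (fun i => 'X_i : {mpoly rat[N]}) k.
have span_line i : path_span i.+1 (L i.+1 predT).
  have := @path_span_path N [:: i.+1] isT.
  by rewrite csfE wcsf_path big_seq1 wcsf_line /= addn0.
elim: j k => [|j IHj] k; first by have := span_line k; rewrite /L line_sumS.
have -> : \sum_c 'X_c ^+ j.+2 * L k (predC1 c) =
    (\sum_c 'X_c ^+ j.+1) * L k.+1 predT
      - \sum_c 'X_c ^+ j.+1 * L k.+1 (predC1 c).
  rewrite big_distrl /= -sumrB; apply: eq_bigr => c _.
  (* The unrestricted sum exceeds the one avoiding [c] by the term [d = c], which supplies the extra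
     factor ['X_c]. *)
  rewrite /L !line_sumS [X in _ * X - _](bigD1 c) //= mulrDr addrK.
  by rewrite mulrA -exprSr.
rewrite addSnnS; apply: path_span_sub; last exact: IHj.
apply: path_span_mul (span_line k).
(* The power sum of degree [j.+1] is the case [k = 0] of the induction hypothesis. *)
have := IHj 0; rewrite addn0; congr path_span.
by apply: eq_bigr => c _; rewrite line_sum0 mulr1.
Qed.

Lemma path_span_power_sum (N j : nat) :
  (0 < j)%N -> path_span j (\sum_(i < N) 'X_i ^+ j).
Proof.
case: j => // j _; have := path_span_weighted_path N j 0.
rewrite addn0; congr path_span.
by apply: eq_bigr => c _; rewrite line_sum0 mulr1.
Qed.

(** Deletion keeps the vertex weights and contraction adds two of them, so the total is preserved.
    Edgeless graphs give products of power sums of positive degree. *)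
Lemma path_span_wcsf (N : nat) (V : finType) (E : rel V) :
  irreflexive E ->
  forall w : V -> nat, (forall v, 0 < w v)%N ->
  path_span (\sum_v w v) (wcsf E (fun v i => 'X_i ^+ w v : {mpoly rat[N]})).
Proof.
move: V E; apply: delcontr_ind => [V E E0 | V E x y Eirr Exy IHd IHc] w w_gt0.
  rewrite wcsf_edgeless //; elim/big_rec2: _ => [|v f d _ IH].
    by have := @path_span_path N [::] isT; rewrite csfE wcsf_path_nil.
  exact: path_span_mul (path_span_power_sum _ (w_gt0 v)) IH.
have nxy : x != y by apply: contraTneq Exy => ->; rewrite Eirr.
rewrite (wcsf_delcontr _ Eirr Exy); apply: path_span_sub; first exact: IHd.
rewrite -(big_contr _ _ nxy).
rewrite (@eq_wcsf _ _ _ _ _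
  (fun u i => 'X_i ^+ contr_weight addn x w u : {mpoly rat[N]})).
  apply: IHc => u; rewrite /contr_weight; case: ifP => _ //.
  by rewrite addn_gt0 w_gt0.
by move=> u i; rewrite /contr_weight; case: ifP => _ //; rewrite exprD.
Qed.

(** * Partitions as padded tuples, and existence of the coefficients *)

(** Sort [s] decreasingly and pad with zeros to length [n]. Positivity of the entries bounds the
    length of [s] by [n] and lets [parts] strip the padding alone. *)
Lemma exists_ptn (n : nat) (s : seq nat) :
  all (leq 1) s -> sumn s = n ->
  exists2 t : n.-tuple 'I_n.+1, is_ptn t & perm_eq (parts t) s.
Proof.
move=> s_gt0 sn.
pose r := sort geq s ++ nseq (n - size s) 0%N.
have size_s : (size s <= n)%N by rewrite -sn size_le_sumn.
(* This bound makes [inord] preserve the entries in [t]. *)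
have r_le i : (nth 0 r i <= n)%N.
  rewrite nth_cat nth_nseq size_sort; case: ltnP => lti; last by case: ifP.
  rewrite -sn; have : nth 0%N (sort geq s) i \in s.
    by rewrite -(mem_sort geq) mem_nth ?size_sort.
  move: (nth _ _ _) => c.
  by elim: (s) => //= a l IHl; rewrite inE => /orP[/eqP->|/IHl]; lia.
pose t : n.-tuple 'I_n.+1 := [tuple inord (nth 0%N r i) | i < n].
have tE : [seq val i | i <- t] = r.
  have size_r : size r = n by rewrite size_cat size_sort size_nseq subnKC.
  apply: (@eq_from_nth _ 0%N) => [|i]; rewrite size_map size_tuple //.
  move=> ltin; rewrite (nth_map ord0) ?size_tuple //.
  rewrite -[i]/(val (Ordinal ltin)) -tnth_nth tnth_mktuple /=.
  by rewrite inordK // ltnS r_le.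
exists t.
  rewrite /is_ptn tE sumn_cat sumn_nseq mul0n addn0.
  rewrite (perm_sumn (permEl (perm_sort geq s))) sn eqxx andbT.
  have geq_trans : transitive geq by move=> a b c; rewrite /geq /=; lia.
  rewrite (sorted_pairwise geq_trans) pairwise_cat.
  rewrite -!(sorted_pairwise geq_trans) sort_sorted; last first.
    by move=> a b; exact: leq_total.
  apply/and3P; split=> //.
    by apply/allrelP => a b _; rewrite mem_nseq => /andP[_ /eqP->].
  by elim: (n - size s)%N => // -[].
rewrite /parts tE filter_cat.
have -> : [seq k <- nseq (n - size s) 0%N | k != 0%N] = [::].
  by elim: (n - size s)%N.
rewrite cats0 (all_filterP _) ?perm_sort // all_sort.
by apply: sub_all s_gt0 => k; rewrite lt0n.
Qed.

Lemma path_span_expansion (N n : nat) (f : {mpoly rat[N]}) :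
  path_span n f ->
  exists a : n.-tuple 'I_n.+1 -> rat,
    f = \sum_(t : n.-tuple 'I_n.+1 | is_ptn t) a t *: csf N (@path_rel (parts t)).
Proof.
elim=> [|s b g s_gt0 sn _ [a ->]].
  by exists (fun=> 0); rewrite big1 // => t _; rewrite scale0r.
have [t ptn_t st] := exists_ptn s_gt0 sn.
exists (fun t' => (if t' == t then b else 0) + a t').
under [RHS]eq_bigr do rewrite scalerDl.
rewrite big_split /=; congr (_ + _).
rewrite (bigD1 t) //= eqxx big1 ?addr0 => [|t' /andP[_ /negPf->]]; last exact: scale0r.
by rewrite (csf_path_perm _ st).
Qed.

(** The chosen coefficients satisfy the expansion as soon as some expansion exists; one comes from
    the weighted result with all weights 1, of total [#|V|]. *)
Lemma path_coeffsP (V : finType) (E : rel V) :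
  irreflexive E -> path_expansion E (path_coeffs E).
Proof.
move=> Eirr; apply: (epsilon_spec (inhabits (fun=> 0)) (path_expansion E)).
apply: path_span_expansion.
have := @path_span_wcsf #|V| V E Eirr (fun=> 1%N) (fun=> isT).
by rewrite sum1_card; congr path_span.
Qed.

Lemma parts_gt0 (n : nat) (t : n.-tuple 'I_n.+1) : all (leq 1) (parts t).
Proof.
by apply/allP => k; rewrite mem_filter lt0n => /andP[].
Qed.

Lemma sumn_parts (n : nat) (t : n.-tuple 'I_n.+1) :
  is_ptn t -> sumn (parts t) = n.
Proof.
case/andP=> _ /eqP sn; rewrite -[RHS]sn /parts.
by elim: [seq val i | i <- t] => //= -[|k] l /= ->.
Qed.

Lemma plen_le (n : nat) (t : n.-tuple 'I_n.+1) : is_ptn t -> (plen t <= n)%N.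
Proof.
move=> ptn_t; rewrite -[X in (_ <= X)%N](sumn_parts ptn_t).
exact: size_le_sumn (parts_gt0 t).
Qed.

(** * Specialisation to the chromatic polynomial and the tree polynomial *)

Lemma meval_csf (N : nat) (V : finType) (E : rel V) (z : 'I_N -> rat) :
  (csf N E).@[z] = wcsf E (fun=> z).
Proof.
rewrite rmorph_sum; apply: eq_bigr => k _.
by rewrite rmorph_prod; apply: eq_bigr => v _; rewrite /= mevalXU.
Qed.

(** Otherwise the nonzero difference, of size at most [n], would have [n] distinct roots. *)
Lemma poly_eq_nat (R : numDomainType) (n : nat) (p q : {poly R}) :
  (size p <= n)%N -> (size q <= n)%N ->
  (forall m, (m < n)%N -> p.[m%:R] = q.[m%:R]) -> p = q.
Proof.
move=> szp szq pq; apply/eqP; rewrite -subr_eq0; apply: contraT => npq.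
have := @max_poly_roots R (p - q) [seq m%:R | m <- iota 0 n] npq.
rewrite size_map size_iota ltnNge (leq_trans (size_polyD _ _)); last first.
  by rewrite size_polyN geq_max szp.
apply; last by rewrite map_inj_uniq ?iota_uniq //; exact: (mulrIn (oner_neq0 R)).
apply/allP => _ /mapP[m + ->]; rewrite mem_iota add0n => /= ltmn.
by rewrite /root hornerD hornerN pq // subrr.
Qed.

Lemma sum_indicator (R : pzSemiRingType) (n m : nat) :
  \sum_(i < n) (i < m)%N%:R = (minn n m)%:R :> R.
Proof.
elim: n => [|n IHn]; first by rewrite big_ord0 min0n.
by rewrite big_ord_recr /= IHn -natrD; congr _%:R; case: ltnP; lia.
Qed.

(** Both sides have size at most [#|V|.+1], so it suffices to compare them at [m] from 0 to [#|V|],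
    the values reached by setting the first [m] of the [#|V|] variables to 1 and the others to 0. *)
Lemma chromatic_poly_expansion (V : finType) (E : rel V) (p : {poly rat}) :
  irreflexive E -> (size p <= #|V|.+1)%N ->
  (forall (N : nat) (z : 'I_N -> rat), (forall i, z i * z i = z i) ->
     wcsf E (fun=> z) = p.[\sum_i z i]) ->
  p = \sum_(t : #|V|.-tuple 'I_#|V|.+1 | is_ptn t)
        path_coeffs E t *: ('X^(plen t) * ('X - 1%:P) ^+ (#|V| - plen t)).
Proof.
move=> Eirr szp hp; apply: (poly_eq_nat szp).
  apply: (leq_trans (size_sum _ _ _)); apply/bigmax_leqP => t ptn_t.
  apply: (leq_trans (size_scale_leq _ _)); apply: (leq_trans (size_polyMleq _ _)).
  rewrite size_polyXn size_exp_XsubC addnS /= addSn subnKC //; exact: plen_le.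
move=> m; rewrite ltnS => lemn.
pose z (i : 'I_#|V|) : rat := (i < m)%N%:R.
have zz i : z i * z i = z i by rewrite /z; case: (i < m)%N; rewrite ?mulr1 ?mulr0.
have zm : \sum_i z i = m%:R by rewrite sum_indicator (minn_idPr lemn).
rewrite -zm -hp // -meval_csf (path_coeffsP Eirr) rmorph_sum horner_sum /=.
apply: eq_bigr => t ptn_t.
rewrite mevalZ meval_csf wcsf_path_idem ?parts_gt0 // sumn_parts //.
by rewrite hornerZ hornerM hornerXn horner_exp hornerXsubC.
Qed.

(** At $q = x/(x-1)$ one has $q-1 = 1/(x-1)$, so $q^l(q-1)^{n-l} = x^l/(x-1)^n$ and the common
    denominator cancels. *)
Lemma tree_poly_eval (V : finType) (E : rel V) (p : {poly rat}) (x : rat) :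
  irreflexive E -> (size p <= #|V|.+1)%N ->
  (forall (N : nat) (z : 'I_N -> rat), (forall i, z i * z i = z i) ->
     wcsf E (fun=> z) = p.[\sum_i z i]) ->
  x != 1 ->
  (tree_poly E).[x] = (x - 1) ^+ #|V| * p.[x / (x - 1)].
Proof.
move=> Eirr szp hp x1; rewrite (chromatic_poly_expansion Eirr szp hp).
have nz : x - 1 != 0 by rewrite subr_eq0.
rewrite !horner_sum big_distrr; apply: eq_bigr => t ptn_t /=.
rewrite !hornerZ hornerM !hornerXn horner_exp hornerXsubC mulrCA; congr (_ * _).
have -> : x / (x - 1) - 1 = (x - 1)^-1 by field.
have -> : (x - 1) ^+ #|V| = (x - 1) ^+ plen t * (x - 1) ^+ (#|V| - plen t).
  by rewrite -exprD subnKC // plen_le.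
rewrite expr_div_n exprVn mulrACA mulfV ?expf_neq0 // mulr1.
by rewrite mulrC divfK // expf_neq0.
Qed.

Theorem theorem4p2 (V : finType) (E : rel V) (E_sym : ssrbool.symmetric E)
    (E_irr : irreflexive E) (x y : V) (Exy : E x y) :
  tree_poly E = tree_poly (del_edge E x y)
                - ('X - 1) * tree_poly (@contr_edge V E x y).
Proof.
have [p szp hp] := chromatic_polyP E_irr.
have [q szq hq] := chromatic_polyP (del_edge_irr x y E_irr).
have [r szr hr] := chromatic_polyP (@contr_edge_irr V E x y).
have cardV : #|V| = #|{: contr_vert y}|.+1.
  by rewrite card_contr_vert prednK //; apply/card_gt0P; exists x.
(* Deletion-contraction for chromatic polynomials, tested with [m] colours all of weight 1. *)
have pqr : p = q - r.
  apply: (poly_eq_nat szp).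
    rewrite (leq_trans (size_polyD _ _)) // size_polyN geq_max szq.
    by apply: leq_trans szr _; rewrite cardV.
  move=> m _; pose z (i : 'I_m) : rat := 1.
  have zm : \sum_i z i = m%:R by rewrite sumr_const card_ord.
  have zz i : z i * z i = z i by exact: mulr1.
  rewrite -zm -hp // (wcsf_delcontr _ E_irr Exy) hq // hornerD hornerN -hr //.
  by congr (_ - _); apply: eq_wcsf => u i; rewrite /contr_weight zz if_same.
have nX1 : 'X - 1%:P != 0 :> {poly rat} by rewrite polyXsubC_eq0.
(* [tree_poly_eval] excludes the point 1; after multiplication by $x-1$ both sides vanish there, so
   all natural numbers can serve as test points. *)
apply: (mulfI nX1); set f := LHS; set g := RHS.
apply: (@poly_eq_nat _ (maxn (size f) (size g))); rewrite ?leq_maxl ?leq_maxr //.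
move=> m _; rewrite /f /g !hornerM hornerXsubC.
have [->|m1] := eqVneq (m%:R : rat) 1; first by rewrite subrr !mul0r.
congr (_ * _); rewrite hornerD hornerN hornerM hornerXsubC.
rewrite (tree_poly_eval E_irr szp hp m1).
rewrite (tree_poly_eval (del_edge_irr x y E_irr) szq hq m1).
rewrite (tree_poly_eval (@contr_edge_irr V E x y) szr hr m1).
(* The contraction has one vertex fewer; the factor $x-1$ makes up for the missing power. *)
by rewrite pqr hornerD hornerN mulrBr mulrA -exprS -cardV.
Qed.
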